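(* Consider a multi-layer SBM with $n$ nodes, $L$ layers and a fixed number $K$ of communities, with sparsity parameter $\rho$ and sampling probability $p\in(0,1]$, and let $\bar M$ and $\Pi$ be as defined in the context. Then: (i) If $\frac{\log(L+n)}{pnL^{1/2}}\lesssim\rho\lesssim\frac{1}{pn}$, then with probability larger than $1-O((L+n)^{-c_1})$ for some constant $c_1>0$, $$\|\bar M-\Pi\|_2\lesssim\max\Big\{\frac{\rho\log(L+n)}{p^{3/2}L^{1/2}},\ \rho^2\Big\}.$$ (ii) If $\rho\gtrsim\frac{\log(L+n)}{pn}$, then with probability larger than $1-O((L+n)^{-c_2})$ for some constant $c_2>0$, $$\|\bar M-\Pi\|_2\lesssim\max\Big\{\frac{n^{1/2}\rho^{3/2}\log^{1/2}(L+n)}{p^{1/2}L^{1/2}},\ \rho^2\Big\}.$$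
   Context: Multi-layer SBM: each node $i\in[n]$ has a label $g_i\in[K]$; $\Theta\in\{0,1\}^{n\times K}$ has $\Theta_{ik}=1$ iff $g_i=k$. For each layer $l$, $B_l=\rho B_{l,0}\in[0,1]^{K\times K}$ is symmetric, with $B_{l,0}$ having nonnegative entries bounded by an absolute constant. The $A_l\in\{0,1\}^{n\times n}$ are symmetric, independent across layers, $A_{l,ii}=0$, and $A_{l,ij}$ ($i<j$) independent $\mathrm{Bernoulli}(B_{l,g_ig_j})$. $P_l=\Theta B_l\Theta^T$ and $\Pi=\frac1L\sum_{l=1}^L P_l^2/n$. Random sampling: for each $l$ and each pair $i<j$, independently, with probability $p$ set $\tilde A_{l,ij}=A_{l,ij}/p$, otherwise $\tilde A_{l,ij}=0$; $\tilde A_{l,ji}=\tilde A_{l,ij}$, $\tilde A_{l,ii}=0$. Let $\tilde d_{l,i}=\#\{j:\tilde A_{l,ij}=1/p\}$, $\tilde D_l=\mathrm{diag}(\tilde d_{l,i})_i$, and $\bar M=\frac1L\sum_{l=1}^L\big(\frac{\tilde A_l^2}{n}-\frac{\tilde D_l}{np^2}\big)$. $\|\cdot\|_2$ is the spectral norm. $f\lesssim g$ means $f\le cg$ for a constant $c>0$ independent of $n,L,p,\rho$. *)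

(* Defs.v *)
From HB Require Import structures.
From mathcomp Require Import all_boot all_order all_algebra.
From mathcomp Require Import all_classical all_reals.
From mathcomp Require Import exp.
Set Implicit Arguments. Unset Strict Implicit. Unset Printing Implicit Defensive.
Import Order.TTheory GRing.Theory Num.Theory.
Local Open Scope classical_set_scope.
Local Open Scope ring_scope.

Section MLSBM.
Variable R : realType.

Definition vnorm2 (n : nat) (x : 'cV[R]_n) : R := Num.sqrt (\sum_i (x i 0) ^+ 2).
Definition spec_norm (n : nat) (M : 'M[R]_n) : R :=
  sup [set vnorm2 (M *m x) | x in [set x : 'cV[R]_n | vnorm2 x = 1]].

Definition Theta (n K : nat) (g : 'I_n -> 'I_K) : 'M[R]_(n, K) :=
  \matrix_(i, k) (if g i == k then 1 else 0).

Definition Pmat (n K : nat) (g : 'I_n -> 'I_K) (rho : R) (B0l : 'M[R]_K) : 'M[R]_n :=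
  Theta g *m (rho *: B0l) *m (Theta g)^T.

Definition Pi (n K L : nat) (g : 'I_n -> 'I_K) (rho : R) (B0 : 'I_L -> 'M[R]_K) : 'M[R]_n :=
  (L%:R)^-1 *: \sum_(l < L) ((n%:R)^-1 *: (Pmat g rho (B0 l) *m Pmat g rho (B0 l))).

(* Sample space: for every layer l and ordered pair (i,j), a pair of bits
   (edge indicator A_{l,ij}, sampling indicator). Only the coordinates with
   i < j are random; the others are a.s. (false,false). *)
Definition Omega (n L : nat) := {ffun 'I_L * 'I_n * 'I_n -> bool * bool}.

Definition coord_weight (n K L : nat) (g : 'I_n -> 'I_K) (rho p : R)
  (B0 : 'I_L -> 'M[R]_K) (l : 'I_L) (i j : 'I_n) (b : bool * bool) : R :=
  if (i < j)%N then
    (if b.1 then rho * B0 l (g i) (g j) else 1 - rho * B0 l (g i) (g j)) *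
    (if b.2 then p else 1 - p)
  else (if b == (false, false) then 1 else 0).

Definition weight (n K L : nat) (g : 'I_n -> 'I_K) (rho p : R)
  (B0 : 'I_L -> 'M[R]_K) (w : Omega n L) : R :=
  \prod_(t : 'I_L * 'I_n * 'I_n) coord_weight g rho p B0 t.1.1 t.1.2 t.2 (w t).

Definition Prob (n K L : nat) (g : 'I_n -> 'I_K) (rho p : R)
  (B0 : 'I_L -> 'M[R]_K) (E : pred (Omega n L)) : R :=
  \sum_(w : Omega n L | E w) weight g rho p B0 w.

Definition sym_bit (n L : nat) (w : Omega n L) (sel : bool * bool -> bool)
  (l : 'I_L) (i j : 'I_n) : bool :=
  if (i < j)%N then sel (w (l, i, j)) else if (j < i)%N then sel (w (l, j, i)) else false.

Definition Aobs (n L : nat) (w : Omega n L) (l : 'I_L) (i j : 'I_n) : bool :=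
  sym_bit w fst l i j.
Definition Smask (n L : nat) (w : Omega n L) (l : 'I_L) (i j : 'I_n) : bool :=
  sym_bit w snd l i j.

Definition Atilde (n L : nat) (p : R) (w : Omega n L) (l : 'I_L) : 'M[R]_n :=
  \matrix_(i, j) (if Smask w l i j then (Aobs w l i j)%:R / p else 0).

Definition dtilde (n L : nat) (p : R) (w : Omega n L) (l : 'I_L) (i : 'I_n) : nat :=
  #|[set j | Atilde p w l i j == p^-1]|.

Definition Dtilde (n L : nat) (p : R) (w : Omega n L) (l : 'I_L) : 'M[R]_n :=
  \matrix_(i, j) (if i == j then (dtilde p w l i)%:R else 0).

Definition Mbar (n L : nat) (p : R) (w : Omega n L) : 'M[R]_n :=
  (L%:R)^-1 *: \sum_(l < L)
    ((n%:R)^-1 *: (Atilde p w l *m Atilde p w l)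
     - (n%:R * p ^+ 2)^-1 *: Dtilde p w l).

End MLSBM.

(* Main.v *)
Require Import Defs.
From HB Require Import structures.
From mathcomp Require Import all_boot all_order all_algebra.
From mathcomp Require Import all_classical all_reals.
From mathcomp Require Import sequences exp.
From mathcomp Require Import ring lra.
Set Implicit Arguments. Unset Strict Implicit. Unset Printing Implicit Defensive.
Import Order.TTheory GRing.Theory Num.Theory.
Local Open Scope ring_scope.

(** Write the observed indicators as rate plus centred noise.  Subtracting the
degrees removes the diagonal of the squared matrices, so that, up to the factor
[(L n p^2)^-1], the deviation splits into the off-diagonal quadratic noise
matrix [Q], a term linear in the noise, and a deterministic bias of norm
[O(L n q^2)], where [q ~ p rho] bounds the rates.

The norm of [Q] is controlled through the trace of [Q ^+ 2N] with [N ~ ln (L + n)].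
In the expectation of a product of noise variables every key that occurs must
occur twice, so it is at most [psi ^ (number of factors) * u ^ (number of
distinct keys)] for any [psi >= 1] with [psi^2 u = q].  Expanding the powers of
[Q] one factor at a time, a step costs [psi^2] times
[L n^2 u^2 + 2 D n u + D^2], where [D = 4N] bounds the number of keys already
visited: its two edges may be new or old.  The choice [psi^2 = sqrt L n q / D]
gives [|Q| = O(sqrt L n q ln (L + n))] after Markov's inequality.  The entries of
the linear term are treated in the same way. *)

(** * Expectation under a finite product law and the basic moment bound *)

Section ProductExpectation.
Variables (R : realFieldType) (T S : finType) (f : T -> S -> R).
Hypothesis f_ge0 : forall t s, 0 <= f t s.
Hypothesis f_sum1 : forall t, \sum_s f t s = 1.

Definition prodw (w : {ffun T -> S}) : R := \prod_t f t (w t).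
Definition expect (F : {ffun T -> S} -> R) : R := \sum_w prodw w * F w.

Lemma prodw_ge0 w : 0 <= prodw w.
Proof. by apply: prodr_ge0 => t _; exact: f_ge0. Qed.

(** Independence of the coordinates: distributing the product over the sums enumerates all functions
    [w]. *)
Lemma expect_prod (phi : T -> S -> R) :
  expect (fun w => \prod_t phi t (w t)) = \prod_t \sum_s f t s * phi t s.
Proof.
rewrite bigA_distr_bigA; apply: eq_bigr => w _.
by rewrite -big_split.
Qed.

Lemma eq_expect F G : F =1 G -> expect F = expect G.
Proof. by move=> FG; apply: eq_bigr => w _; rewrite FG. Qed.

Lemma expect_sum (I : finType) (P : pred I) (F : I -> {ffun T -> S} -> R) :
  expect (fun w => \sum_(i | P i) F i w) = \sum_(i | P i) expect (F i).
Proof.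
rewrite exchange_big; apply: eq_bigr => w _.
by rewrite mulr_sumr.
Qed.

Lemma expectZ a F : expect (fun w => a * F w) = a * expect F.
Proof. by rewrite mulr_sumr; apply: eq_bigr => w _; rewrite mulrCA. Qed.

Lemma expect_cst a : expect (fun=> a) = a.
Proof.
rewrite /expect -mulr_suml (_ : \sum_w _ = \prod_t \sum_s f t s) ?bigA_distr_bigA //.
by rewrite -bigA_distr_bigA big1 ?mul1r.
Qed.

Lemma markov_prodw (F : {ffun T -> S} -> R) (c : R) : 0 < c ->
  (forall w, 0 <= F w) ->
  \sum_(w | c < F w) prodw w <= expect F / c.
Proof.
move=> c0 F0; rewrite ler_pdivlMr // mulr_suml big_mkcond.
apply: ler_sum => w _; case: ifP => [cF|_].
  by rewrite ler_wpM2l ?prodw_ge0 // ltW.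
by rewrite mulr_ge0 ?prodw_ge0.
Qed.

Variables (y : T -> S -> R) (psi u : R).
Hypothesis y_le1 : forall t s, `|y t s| <= 1.
Hypothesis y_mean0 : forall t, \sum_s f t s * y t s = 0.
Hypothesis y_var : forall t, \sum_s f t s * y t s ^+ 2 <= psi ^+ 2 * u.
Hypothesis psi_ge1 : 1 <= psi.
Hypothesis u_ge0 : 0 <= u.

(** Centring kills [m = 1]. For [m >= 2], [|y| <= 1] reduces the moment to the variance, and
    [psi >= 1] pads [psi ^+ 2] up to [psi ^+ m]. *)
Lemma moment_single t m :
  `|\sum_s f t s * y t s ^+ m| <= psi ^+ m * (if (0 < m)%N then u else 1).
Proof.
have psi0 : 0 <= psi by apply: le_trans psi_ge1.
case: m => [|[|m]].
- under eq_bigr do rewrite expr0 mulr1.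
  by rewrite f_sum1 normr1 expr0 mul1r.
- by under eq_bigr do rewrite expr1; rewrite y_mean0 normr0 mulr_ge0 ?exprn_ge0.
- apply: le_trans (_ : psi ^+ 2 * u <= _); last first.
    by rewrite /= ler_wpM2r // ler_weXn2l.
  apply: le_trans (y_var t); apply: le_trans (ler_norm_sum _ _ _) _.
  apply: ler_sum => s _; rewrite normrM ger0_norm // ler_wpM2l //.
  rewrite normrX -[X in _ <= X]real_normK ?num_real // -addn2 exprD.
  by rewrite ler_piMl ?exprn_ge0 // exprn_ile1.
Qed.

(** Regrouping a word by its letters gives one factor per coordinate, the form that [expect_prod]
    factorises. *)
Lemma prodr_count (V : comNzRingType) (ks : seq T) (F : T -> V) :
  \prod_(x <- ks) F x = \prod_t F t ^+ count_mem t ks.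
Proof.
elim: ks => [|a ks IH]; first by rewrite big_nil big1.
rewrite big_cons IH [RHS](bigD1 a) //= eqxx exprS (bigD1 a) //= mulrA.
by congr (_ * _); apply: eq_bigr => t ta; rewrite [a == t]eq_sym (negPf ta).
Qed.

(* A factor psi^size is traded for the replacement of the variance bound
   psi^2 u by u: this is the free parameter that is optimised at the end. *)
Lemma moment_bound (ks : seq T) :
  `|expect (fun w => \prod_(x <- ks) y x (w x))|
    <= psi ^+ size ks * u ^+ size (undup ks).
Proof.
under eq_expect do rewrite prodr_count.
rewrite (expect_prod (fun t s => y t s ^+ count_mem t ks)) normr_prod.
apply: le_trans (_ : \prod_t (psi ^+ count_mem t ks *
    (if (0 < count_mem t ks)%N then u else 1)) <= _).
  by apply: ler_prod => t _; rewrite normr_ge0 moment_single.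
rewrite big_split /= -(prodr_count ks (fun=> psi)).
rewrite big_const_seq count_predT iter_mulr_1.
rewrite -big_mkcond prodr_const -(card_uniqP (undup_uniq ks)).
rewrite (_ : #|_| = #|undup ks|) //; apply: eq_card => t.
by rewrite [RHS]mem_undup -has_pred1 has_count.
Qed.

End ProductExpectation.

(** * Edge keys: the coordinate carrying an undirected edge, and counting keys around a vertex *)

Definition ekey (n L : nat) (l : 'I_L) (i j : 'I_n) : 'I_L * 'I_n * 'I_n :=
  if (i < j)%N then (l, i, j) else (l, j, i).

Section EdgeKeys.
Variables (n L : nat).
Implicit Types (l : 'I_L) (i j k m : 'I_n).

Lemma ekey_sym l i j : ekey l i j = ekey l j i.
Proof.
by rewrite /ekey; case: ltngtP => // /val_inj->.
Qed.

Lemma ekey_injr i : injective (fun p : 'I_L * 'I_n => ekey p.1 i p.2).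
Proof.
move=> [l k] [l' k'] /=; rewrite /ekey.
by case: ifP => ik; case: ifP => ik' [] *; subst => //; rewrite ?ik ?ik' in ik *.
Qed.

(** The two edges of a step between distinct endpoints never coincide. This is where the removal of
    the diagonal pays off: without it a step could use a single new key twice. *)
Lemma ekey_adjacent_neq l i k m : m != i -> ekey l i k != ekey l k m.
Proof.
move=> mi; apply: contra mi; rewrite [ekey l i k]ekey_sym => /eqP.
by move=> E; have [->] := @ekey_injr k (l, i) (l, m) E.
Qed.

(** By [ekey_injr] each visited key is reached from [i] in at most one way, so an old edge leaves at
    most [size ks] choices instead of [L * n]. *)
Lemma sum_ekey_mem (R : realFieldType) (ks : seq ('I_L * 'I_n * 'I_n)) i :
  \sum_l \sum_k (ekey l i k \in ks)%:R <= (size ks)%:R :> R.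
Proof.
rewrite pair_big /= -natr_sum ler_nat.
rewrite (_ : \sum_p _ = #|[pred p : 'I_L * 'I_n | ekey p.1 i p.2 \in ks]|)%N; last first.
  by rewrite -sum1_card [RHS]big_mkcond; apply: eq_bigr => p _; rewrite inE; case: (_ \in _).
rewrite -(fintype.card_image (@ekey_injr i)) cardE uniq_leq_size ?enum_uniq // => x.
by rewrite mem_enum => /mapP[p]; rewrite mem_enum => pks ->.
Qed.
End EdgeKeys.

(** * Moments of linear and quadratic forms in the noise, one factor at a time *)

Section CenteredWalks.
Variables (R : realFieldType) (n L : nat) (S : finType).
Local Notation key := ('I_L * 'I_n * 'I_n)%type.
Variables (f : key -> S -> R) (y : key -> S -> R) (psi u : R).
Hypothesis f_ge0 : forall t s, 0 <= f t s.
Hypothesis f_sum1 : forall t, \sum_s f t s = 1.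
Hypothesis y_le1 : forall t s, `|y t s| <= 1.
Hypothesis y_mean0 : forall t, \sum_s f t s * y t s = 0.
Hypothesis y_var : forall t, \sum_s f t s * y t s ^+ 2 <= psi ^+ 2 * u.
Hypothesis psi_ge1 : 1 <= psi.
Hypothesis u_ge0 : 0 <= u.
Implicit Types (w : {ffun key -> S}) (ks : seq key).

Definition centered w (l : 'I_L) (i j : 'I_n) : R :=
  y (ekey l i j) (w (ekey l i j)).

Definition quad w : 'M[R]_n :=
  \matrix_(i, j) (if i == j then 0
                  else \sum_l \sum_k centered w l i k * centered w l k j).

Definition linform (b : 'I_L -> 'I_n -> R) (i : 'I_n) w : R :=
  \sum_l \sum_k b l k * centered w l i k.

Let mono ks w := \prod_(x <- ks) y x (w x).

(** An old key costs 1 and a new one [u]. Bounding the cost by a sum rather than a case distinction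
    lets the sum over keys split. *)
Lemma expr_size_undup_cons x ks :
  u ^+ size (undup (x :: ks)) <= ((x \in ks)%:R + u) * u ^+ size (undup ks).
Proof.
rewrite /=; case: ifP => xks /=.
  by rewrite mulrDl mul1r lerDl mulr_ge0 ?exprn_ge0.
by rewrite add0r exprS.
Qed.

(** Induction on [T] over all words [ks]: expanding one factor moves one key into [ks], so
    [size ks + T] is invariant and [D] stays a valid bound. A factor costs [beta] times [L n u] for
    a new key plus [D] for an old one. *)
Lemma linform_moment (beta : R) (b : 'I_L -> 'I_n -> R) (i : 'I_n) (D T : nat) :
  (forall l k, `|b l k| <= beta) -> 0 <= beta ->
  forall ks, (size ks + T <= D)%N ->
  `|expect f (fun w => mono ks w * linform b i w ^+ T)| <=
     psi ^+ (size ks + T) * u ^+ size (undup ks) *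
     (beta * (L%:R * n%:R * u + D%:R)) ^+ T.
Proof.
move=> b_le beta0; have psi0 : 0 <= psi by apply: le_trans psi_ge1.
have W0 : 0 <= beta * (L%:R * n%:R * u + D%:R).
  by rewrite mulr_ge0 // addr_ge0 // !mulr_ge0.
elim: T => [|T IH] ks szD.
  under eq_expect do rewrite expr0 mulr1.
  by rewrite expr0 mulr1 addn0 moment_bound.
rewrite (@eq_expect _ _ _ _ _ (fun w => \sum_(s : 'I_L * 'I_n)
   b s.1 s.2 * (mono (ekey s.1 i s.2 :: ks) w * linform b i w ^+ T))); last first.
  move=> w; rewrite exprS mulrCA [linform b i w]pair_big /= mulr_suml.
  by apply: eq_bigr => s _; rewrite /mono big_cons /centered; ring.
rewrite expect_sum; apply: le_trans (ler_norm_sum _ _ _) _.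
pose c := psi ^+ (size ks + T.+1) * (beta * (L%:R * n%:R * u + D%:R)) ^+ T.
apply: le_trans (_ : \sum_(s : 'I_L * 'I_n) c * u ^+ size (undup ks) * beta *
   ((ekey s.1 i s.2 \in ks)%:R + u) <= _).
  apply: ler_sum => s _; rewrite expectZ normrM.
  apply: le_trans (ler_pM _ _ (b_le _ _) (IH _ _)) _ => //=.
    by rewrite addSnnS.
  rewrite addSnnS.
  have /(ler_wpM2l _) := expr_size_undup_cons (ekey s.1 i s.2) ks.
  have : 0 <= beta * c by rewrite !mulr_ge0 ?exprn_ge0.
  move=> c0 /(_ _ c0); rewrite /c; set A := u ^+ size (undup ks).
  rewrite /= -/A; set X := u ^+ _; set P := _ ^+ (_ + _); set Q := (_ * _) ^+ T.
  by move=> H; lra.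
rewrite -mulr_sumr big_split /= -(pair_bigA _ (fun l k => (ekey l i k \in ks)%:R)) /=.
rewrite [X in _ <= X](_ : _ = c * u ^+ size (undup ks) * beta *
  (L%:R * n%:R * u + D%:R)); last by rewrite /c [in LHS]exprS; ring.
rewrite ler_wpM2l ?mulr_ge0 ?exprn_ge0 //.
rewrite sumr_const card_prod !card_ord -[u *+ _]mulr_natl natrM addrC.
rewrite lerD2l (le_trans (sum_ekey_mem _ _ _)) // ler_nat.
by rewrite (leq_trans _ szD) // leq_addr.
Qed.

(** The same induction with two keys per factor. The leftmost factor is expanded, so the start [i]
    moves to the next vertex while [j] stays fixed. The terms of [W] count two new keys, one new and
    one old, and two old. *)
Lemma quad_moment (D T : nat) ks i j : (size ks + T.*2 <= D)%N ->
  `|expect f (fun w => mono ks w * (quad w ^+ T) i j)| <=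
     psi ^+ (size ks + T.*2) * u ^+ size (undup ks) *
     (L%:R * n%:R ^+ 2 * u ^+ 2 + 2 * D%:R * n%:R * u + D%:R ^+ 2) ^+ T.
Proof.
set W := (_ + _ + _).
have psi0 : 0 <= psi by apply: le_trans psi_ge1.
have W0 : 0 <= W by rewrite !addr_ge0 ?mulr_ge0 ?exprn_ge0.
elim: T => [|T IH] in ks i * => szD.
  (* The zeroth power is the identity, whose entry is 0 or 1. *)
  under eq_expect do rewrite expr0 mxE mulrC.
  rewrite expectZ normrM expr0 mulr1 addn0 normr_nat.
  rewrite -[X in _ <= X]mul1r; apply: ler_pM => //; first by rewrite lern1 leq_b1.
  exact: moment_bound.
pose x1 (s : 'I_n * ('I_L * 'I_n)) := ekey s.2.1 i s.2.2.
pose x2 (s : 'I_n * ('I_L * 'I_n)) := ekey s.2.1 s.2.2 s.1.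
rewrite (@eq_expect _ _ _ _ _ (fun w => \sum_(s : 'I_n * ('I_L * 'I_n) | s.1 != i)
   mono (x1 s :: x2 s :: ks) w * (quad w ^+ T) s.1 j)); last first.
  move=> w; rewrite exprS mxE big_distrr /= [RHS]big_mkcond /=.
  rewrite -(pair_bigA _ (fun m t => if m != i then
     mono (x1 (m, t) :: x2 (m, t) :: ks) w * (quad w ^+ T) m j else 0)) /=.
  apply: eq_bigr => m _; rewrite [quad w i m]mxE eq_sym.
  case: eqP => [_|_] /=; first by rewrite mul0r mulr0 big1.
  rewrite pair_big /= mulr_suml mulr_sumr; apply: eq_bigr => s _.
  by rewrite /mono !big_cons /centered /x1 /x2 /=; ring.
rewrite expect_sum; apply: le_trans (ler_norm_sum _ _ _) _.
pose c := psi ^+ (size ks + T.+1.*2) * W ^+ T.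
pose a x : R := (x \in ks)%:R.
have a0 x : 0 <= a x + u by rewrite addr_ge0.
have sks : (size ks <= D)%N by rewrite (leq_trans _ szD) // leq_addr.
apply: le_trans (_ : \sum_(s : 'I_n * ('I_L * 'I_n)) c * u ^+ size (undup ks) *
   ((a (x1 s) + u) * (a (x2 s) + u)) <= _).
  rewrite big_mkcond /=; apply: ler_sum => s _.
  have c0 : 0 <= c by rewrite !mulr_ge0 ?exprn_ge0.
  case: ifPn => si; last by rewrite !mulr_ge0 ?exprn_ge0.
  have sz2 : (size [:: x1 s, x2 s & ks] + T.*2 = size ks + T.+1.*2)%N.
    by rewrite /= doubleS !addnS.
  apply: le_trans (IH _ _ _) _; first by rewrite sz2.
  rewrite sz2 mulrAC -/c -mulrA ler_wpM2l //.
  apply: le_trans (expr_size_undup_cons _ _) _.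
  (* Since [x1] differs from [x2], its novelty is tested against [ks] alone, and the two costs
     multiply. *)
  rewrite inE (negPf (ekey_adjacent_neq _ _ si)) orFb [leRHS]mulrC -mulrA.
  by rewrite ler_wpM2l ?a0 // expr_size_undup_cons.
rewrite -mulr_sumr [X in _ <= X](_ : _ = c * u ^+ size (undup ks) * W); last first.
  by rewrite /c [in LHS]exprS; ring.
rewrite ler_wpM2l ?mulr_ge0 ?exprn_ge0 //.
rewrite -(pair_bigA _ (fun m t => (a (ekey t.1 i t.2) + u) * (a (ekey t.1 t.2 m) + u))) /=.
have aD v : \sum_(p : 'I_L * 'I_n) a (ekey p.1 v p.2) <= D%:R.
  rewrite -(pair_bigA _ (fun l k => a (ekey l v k))) /=.
  by rewrite (le_trans (sum_ekey_mem _ _ _)) // ler_nat.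
have am (t : 'I_L * 'I_n) : \sum_m a (ekey t.1 t.2 m) <= D%:R.
  apply: le_trans (aD t.2); rewrite -(pair_bigA _ (fun l k => a (ekey l t.2 k))) /=.
  by rewrite (bigD1 t.1) //= lerDl !sumr_ge0 // => *; rewrite ?sumr_ge0.
(* At most [D] old keys meet each of the [n] middle vertices. Multiplied by [u] for a new first
   edge, this matches the [D n u] of the opposite case. *)
have sum_b : \sum_(t : 'I_L * 'I_n) \sum_m a (ekey t.1 t.2 m) <= n%:R * D%:R.
  rewrite -(pair_bigA _ (fun l k => \sum_m a (ekey l k m))) exchange_big /=.
  apply: le_trans (_ : \sum_(k < n) D%:R <= _); last first.
    by rewrite sumr_const card_ord mulr_natl.
  by apply: ler_sum => k _; rewrite pair_big; exact: (aD k).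
rewrite exchange_big /=.
apply: le_trans (_ : \sum_(t : 'I_L * 'I_n) (a (ekey t.1 i t.2) * (D%:R + n%:R * u) +
   (u * (\sum_m a (ekey t.1 t.2 m)) + n%:R * u ^+ 2)) <= _).
  apply: ler_sum => t _.
  rewrite -mulr_sumr big_split /= sumr_const card_ord -[u *+ n]mulr_natl.
  have := am t; set B := \sum_m _ => BD.
  have : 0 <= a (ekey t.1 i t.2) by [].
  set A := a _ => A0; have /(ler_wpM2l A0) := BD.
  by move=> H; nra.
rewrite !big_split /= -mulr_suml -mulr_sumr sumr_const card_prod !card_ord.
rewrite -[(_ * u ^+ 2) *+ _]mulr_natl natrM.
have H1 := ler_wpM2r (addr_ge0 (ler0n R D) (mulr_ge0 (ler0n R n) u_ge0)) (aD i).
have H2 := ler_wpM2l u_ge0 sum_b.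
rewrite /W; apply: le_trans (lerD H1 (lerD H2 (lexx _))) _.
by rewrite le_eqVlt; apply/orP; left; apply/eqP; ring.
Qed.
End CenteredWalks.

(** * Cauchy-Schwarz, squared Euclidean norms and traces of powers *)

Lemma cauchy_schwarz_sum (R : realFieldType) (I : finType) (a b : I -> R) :
  (\sum_i a i * b i) ^+ 2 <= (\sum_i a i ^+ 2) * (\sum_i b i ^+ 2).
Proof.
(* Lagrange's identity: this double sum is twice the gap in the inequality. *)
have : 0 <= \sum_i \sum_j (a i * b j - a j * b i) ^+ 2.
  by apply: sumr_ge0 => i _; apply: sumr_ge0 => j _; rewrite sqr_ge0.
rewrite (_ : \sum_i _ = 2 * ((\sum_i a i ^+ 2) * (\sum_i b i ^+ 2) -
   (\sum_i a i * b i) ^+ 2)); first by rewrite pmulr_rge0 // subr_ge0.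
rewrite expr2 !big_distrlr /= -sumrB mulr_sumr.
rewrite (_ : \sum_i _ = \sum_i \sum_j (a i ^+ 2 * b j ^+ 2 - a i * b i * (a j * b j))
  + \sum_i \sum_j (a j ^+ 2 * b i ^+ 2 - a i * b i * (a j * b j))); last first.
  rewrite -big_split; apply: eq_bigr => i _; rewrite -big_split; apply: eq_bigr => j _ /=.
  by ring.
rewrite [X in _ + X]exchange_big /= -big_split; apply: eq_bigr => i _ /=.
rewrite -sumrB mulr_sumr -big_split; apply: eq_bigr => j _ /=; ring.
Qed.

Section SquaredNorm.
Variables (R : realFieldType) (n : nat).
Implicit Types (M Q : 'M[R]_n) (x v : 'cV[R]_n).

(** Squares keep the matrix estimates free of roots; [vnorm2] is the root of this sum. *)
Definition sqnorm x : R := \sum_i x i 0 ^+ 2.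

Lemma sqnorm_ge0 x : 0 <= sqnorm x.
Proof. by apply: sumr_ge0 => i _; rewrite sqr_ge0. Qed.

Lemma sqnormE x : sqnorm x = (x^T *m x) 0 0.
Proof. by rewrite mxE; apply: eq_bigr => i _; rewrite mxE expr2. Qed.

Lemma sqnormZ a x : sqnorm (a *: x) = a ^+ 2 * sqnorm x.
Proof. by rewrite mulr_sumr; apply: eq_bigr => i _; rewrite mxE exprMn. Qed.

Lemma sqnormD3 x1 x2 x3 :
  sqnorm (x1 + x2 + x3) <= 3 * (sqnorm x1 + sqnorm x2 + sqnorm x3).
Proof.
rewrite -!big_split mulr_sumr; apply: ler_sum => i _; rewrite !mxE /=.
move: (x1 i 0) (x2 i 0) (x3 i 0) => a b c.
by have := sqr_ge0 (a - b); have := sqr_ge0 (a - c); have := sqr_ge0 (b - c); nra.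
Qed.

Lemma sqnorm_mulmx_frobenius M x :
  sqnorm (M *m x) <= (\sum_i \sum_j M i j ^+ 2) * sqnorm x.
Proof.
by rewrite mulr_suml; apply: ler_sum => i _; rewrite mxE cauchy_schwarz_sum.
Qed.

Lemma sqnorm_mulmx_entries M x (h : R) : (forall i j, `|M i j| <= h) ->
  sqnorm (M *m x) <= (n%:R * h) ^+ 2 * sqnorm x.
Proof.
move=> Mh; apply: le_trans (sqnorm_mulmx_frobenius _ _) _.
rewrite ler_wpM2r ?sqnorm_ge0 //.
apply: le_trans (_ : \sum_(i < n) \sum_(j < n) h ^+ 2 <= _).
  apply: ler_sum => i _; apply: ler_sum => j _.
  by rewrite -[leLHS]real_normK ?num_real // lerXn2r ?nnegrE // (le_trans _ (Mh i j)).
rewrite !sumr_const card_ord -mulrnA -[leLHS]mulr_natl natrM exprMn -expr2.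
by [].
Qed.

Lemma sqnorm_mulmx_diag M x (d : R) :
  (forall i j, i != j -> M i j = 0) -> (forall i, `|M i i| <= d) ->
  sqnorm (M *m x) <= d ^+ 2 * sqnorm x.
Proof.
move=> Mdiag Md; rewrite mulr_sumr; apply: ler_sum => i _.
rewrite mxE (bigD1 i) //= big1 ?addr0 => [|j ji]; last first.
  by rewrite Mdiag ?mul0r // eq_sym.
rewrite exprMn ler_wpM2r ?sqr_ge0 //.
by rewrite -[leLHS]real_normK ?num_real // lerXn2r ?nnegrE // (le_trans _ (Md i)).
Qed.

Lemma trmx_exp Q k : Q^T = Q -> (Q ^+ k)^T = Q ^+ k.
Proof.
move=> Qs; elim: k => [|k IH]; first by rewrite expr0 trmx1.
by rewrite exprSr trmx_mul Qs IH -[LHS]/(Q * Q ^+ k) -exprS exprSr.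
Qed.

(** Repeated squaring stands in for the spectral theorem: for symmetric [P] and a unit vector,
    [|P x|^2 = <x, P^2 x> <= |P^2 x|]. *)
Lemma sqnorm_pow2 Q x k : Q^T = Q -> sqnorm x = 1 ->
  sqnorm (Q *m x) ^+ (2 ^ k) <= sqnorm (Q ^+ (2 ^ k) *m x).
Proof.
move=> Qs x1; elim: k => [|k IH]; first by rewrite !expr1.
rewrite expnSr !exprM; apply: le_trans (_ : sqnorm (Q ^+ (2 ^ k) *m x) ^+ 2 <= _).
  by rewrite lerXn2r // nnegrE ?exprn_ge0 ?sqnorm_ge0.
set P := Q ^+ (2 ^ k).
have -> : sqnorm (P *m x) = \sum_i x i 0 * (P ^+ 2 *m x) i 0.
  rewrite sqnormE trmx_mul trmx_exp // -mulmxA [P *m (_ *m _)]mulmxA mxE.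
  by apply: eq_bigr => i _; rewrite mxE.
by apply: le_trans (cauchy_schwarz_sum _ _) _; rewrite -/(sqnorm x) x1 mul1r.
Qed.

(** The squared Frobenius norm of a symmetric power is the trace of its square. *)
Lemma sqnorm_pow2_trace Q x k : Q^T = Q -> sqnorm x = 1 ->
  sqnorm (Q *m x) ^+ (2 ^ k) <= \tr (Q ^+ (2 ^ k).*2).
Proof.
move=> Qs x1; apply: le_trans (sqnorm_pow2 k Qs x1) _.
apply: le_trans (sqnorm_mulmx_frobenius _ _) _; rewrite x1 mulr1.
rewrite -addnn exprD; apply: ler_sum => i _; rewrite mxE; apply: ler_sum => j _.
by rewrite -{3}(trmx_exp _ Qs) mxE expr2.
Qed.

Lemma trace_pow_ge0 Q N : Q^T = Q -> 0 <= \tr (Q ^+ N.*2).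
Proof.
move=> Qs; rewrite -addnn exprD; apply: sumr_ge0 => i _; rewrite mxE.
by apply: sumr_ge0 => j _; rewrite -{2}(trmx_exp _ Qs) mxE -expr2 sqr_ge0.
Qed.

End SquaredNorm.

(** * Choice of [psi], tail bounds and the union bound *)

Section Concentration.
Variables (R : realType) (n L : nat) (S : finType).
Local Notation key := ('I_L * 'I_n * 'I_n)%type.
Variables (f : key -> S -> R) (y : key -> S -> R) (q : R).
Hypothesis f_ge0 : forall t s, 0 <= f t s.
Hypothesis f_sum1 : forall t, \sum_s f t s = 1.
Hypothesis y_le1 : forall t s, `|y t s| <= 1.
Hypothesis y_mean0 : forall t, \sum_s f t s * y t s = 0.
Hypothesis y_var : forall t, \sum_s f t s * y t s ^+ 2 <= q.
Hypotheses (n_gt0 : (0 < n)%N) (L_gt0 : (0 < L)%N) (q_gt0 : 0 < q).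
Variables (k D : nat).
Hypothesis DE : D = (4 * 2 ^ k)%N.

Local Notation e := (expR 1 : R).
Let D0 : 0 < D%:R :> R.
Proof. by rewrite ltr0n DE muln_gt0 expn_gt0. Qed.
Let n0 : 0 < n%:R :> R. Proof. by rewrite ltr0n. Qed.
Let L0 : 0 < L%:R :> R. Proof. by rewrite ltr0n. Qed.
Let sL1 : 1 <= Num.sqrt L%:R :> R.
Proof. by rewrite -[leLHS]sqrtr1 ler_wsqrtr // ler1n. Qed.
Let sL2 : Num.sqrt L%:R ^+ 2 = L%:R :> R.
Proof. by rewrite sqr_sqrtr. Qed.

Lemma quad_sym w : (quad y w)^T = quad y w.
Proof.
apply/matrixP => i j; rewrite !mxE eq_sym; case: eqP => // _.
apply: eq_bigr => l _; apply: eq_bigr => m _.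
by rewrite mulrC /centered ![ekey l _ m]ekey_sym ![ekey l m _]ekey_sym.
Qed.

(** The two scales are the costs per factor in the optimised moment bounds; [e] times a scale is the
    threshold in the tails. *)
Definition quad_scale : R := 4 * D%:R * (Num.sqrt L%:R * n%:R * q).
Definition linform_scale (beta : R) : R := 2 * beta * Num.sqrt (L%:R * n%:R * q * D%:R).

(* The choice psi^2 = sqrt L * n * q / D balances the extreme terms of psi^2 W. *)
Lemma quad_trace_moment : D%:R <= Num.sqrt L%:R * n%:R * q ->
  expect f (fun w => \tr (quad y w ^+ (2 ^ k).*2)) <= n%:R * quad_scale ^+ (2 ^ k).*2.
Proof.
move=> Dle; set X := Num.sqrt L%:R * n%:R * q in Dle *.
have X0 : 0 < X by apply: lt_le_trans Dle.
pose psi := Num.sqrt (X / D%:R).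
have psi2 : psi ^+ 2 = X / D%:R by rewrite sqr_sqrtr // divr_ge0 // ltW.
have psi1 : 1 <= psi by rewrite -[leLHS]sqrtr1 ler_wsqrtr // ler_pdivlMr // mul1r.
pose u := q / psi ^+ 2.
have u0 : 0 <= u by rewrite divr_ge0 ?sqr_ge0 // ltW.
have var t : \sum_s f t s * y t s ^+ 2 <= psi ^+ 2 * u.
  by rewrite /u mulrCA mulfV ?mulr1 // psi2 mulf_neq0 ?invr_neq0 ?gt_eqF.
rewrite expect_sum; apply: le_trans (_ : \sum_(i < n) quad_scale ^+ (2 ^ k).*2 <= _).
  2: by rewrite sumr_const card_ord mulr_natl.
apply: ler_sum => i _; have uE : u = q / psi ^+ 2 by [].
clearbody u; apply: le_trans (ler_norm _) _.
rewrite (@eq_expect _ _ _ _ _ (fun w => \prod_(x <- [::]) y x (w x) *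
  (quad y w ^+ (2 ^ k).*2) i i)); last by move=> w; rewrite big_nil mul1r.
have := @quad_moment R n L S f y psi u f_ge0 f_sum1 y_le1 y_mean0 var psi1 u0 D
  (2 ^ k).*2 [::] i i.
(* [2 * 2 ^ k] factors with two keys each: [D] is exactly the total number of keys. *)
have TD : (size ([::] : seq key) + (2 ^ k).*2.*2 = D)%N.
  by rewrite DE add0n -!mul2n mulnA.
rewrite TD => /(_ (leqnn _)) H.
apply: le_trans H _; rewrite expr0 mulr1 -{1}TD add0n -[X in psi ^+ X]mul2n.
rewrite exprM -exprMn lerXn2r // ?nnegrE.
- by rewrite mulr_ge0 ?sqr_ge0 // !addr_ge0 ?mulr_ge0 ?sqr_ge0.
- by rewrite /quad_scale -/X; apply: mulr_ge0; [rewrite mulr_ge0|exact: ltW].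
(* Each extreme term contributes [D * X]; the middle one is at most [2 * D * X] because
   [sqrt L >= 1]. Together they give the 4 of [quad_scale]. *)
have -> : psi ^+ 2 * (L%:R * n%:R ^+ 2 * u ^+ 2 + 2 * D%:R * n%:R * u + D%:R ^+ 2) =
  2 * D%:R * X + 2 * D%:R * (n%:R * q).
  rewrite uE psi2 -sL2 /X; field; rewrite !gt_eqF //.
  by rewrite (lt_le_trans _ sL1).
have : n%:R * q <= X by rewrite /X -mulrA ler_peMl // mulr_ge0 ?ltW.
move=> /(ler_wpM2l (ltW D0)); rewrite /quad_scale -/X; lra.
Qed.

(** With [psi^2 = L n q / D] the cost [L n u] of a new key equals [D], so a factor costs
    [2 beta psi D], which is [linform_scale beta]. *)
Lemma linform_even_moment (beta : R) (b : 'I_L -> 'I_n -> R) i :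
  D%:R <= L%:R * n%:R * q -> (forall l j, `|b l j| <= beta) ->
  expect f (fun w => linform y b i w ^+ D) <= linform_scale beta ^+ D.
Proof.
move=> Dle b_le; set X := L%:R * n%:R * q in Dle *.
have beta0 : 0 <= beta by apply: le_trans (b_le (Ordinal L_gt0) (Ordinal n_gt0)).
have X0 : 0 < X by apply: lt_le_trans Dle.
pose psi := Num.sqrt (X / D%:R).
have psi2 : psi ^+ 2 = X / D%:R by rewrite sqr_sqrtr // divr_ge0 // ltW.
have psi1 : 1 <= psi by rewrite -[leLHS]sqrtr1 ler_wsqrtr // ler_pdivlMr // mul1r.
have psi0 : 0 < psi by apply: lt_le_trans psi1.
pose u := q / psi ^+ 2.
have u0 : 0 <= u by rewrite divr_ge0 ?sqr_ge0 // ltW.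
have var t : \sum_s f t s * y t s ^+ 2 <= psi ^+ 2 * u.
  by rewrite /u mulrCA mulfV ?mulr1 // psi2 mulf_neq0 ?invr_neq0 ?gt_eqF.
have uE : u = q / psi ^+ 2 by [].
clearbody u; apply: le_trans (ler_norm _) _.
rewrite (@eq_expect _ _ _ _ _ (fun w => \prod_(x <- [::]) y x (w x) *
  linform y b i w ^+ D)); last by move=> w; rewrite big_nil mul1r.
have := @linform_moment R n L S f y psi u f_ge0 f_sum1 y_le1 y_mean0 var psi1 u0
  beta b i D D b_le beta0 [::].
rewrite add0n => /(_ (leqnn _)) H.
apply: le_trans H _; rewrite expr0 mulr1 -exprMn.
rewrite le_eqVlt; apply/orP; left; apply/eqP; congr (_ ^+ _).
have XE : X = psi ^+ 2 * D%:R by rewrite psi2 divfK // gt_eqF.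
have sq : Num.sqrt (X * D%:R) = psi * D%:R.
  by rewrite XE -mulrA -expr2 -exprMn sqrtr_sqr ger0_norm // mulr_ge0 // ltW.
rewrite /linform_scale -/X sq.
have -> : L%:R * n%:R * u = X / psi ^+ 2 by rewrite uE /X mulrA.
by rewrite XE; field; rewrite gt_eqF.
Qed.

(** Markov at [e] times the scale turns the order of the moment into exponential decay; the
    dimension [n] of the trace enters only the probability. *)
Lemma quad_tail : D%:R <= Num.sqrt L%:R * n%:R * q ->
  \sum_(w | (e * quad_scale) ^+ (2 ^ k).*2 < \tr (quad y w ^+ (2 ^ k).*2)) prodw f w
    <= n%:R / e ^+ (2 ^ k).*2.
Proof.
move=> Dle; have s0 : 0 < quad_scale.
  by rewrite !mulr_gt0 // (lt_le_trans _ sL1).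
have e0 : 0 < e by exact: expR_gt0.
have es0 := mulr_gt0 e0 s0.
apply: le_trans (markov_prodw f_ge0 (exprn_gt0 _ es0) _) _.
  by move=> w; apply: trace_pow_ge0; exact: quad_sym.
rewrite ler_pdivrMr ?(exprn_gt0 _ es0) //.
apply: le_trans (quad_trace_moment Dle) _.
by rewrite [in leRHS]exprMn mulrA divfK // gt_eqF // exprn_gt0.
Qed.

Lemma linform_tail (beta : R) (b : 'I_L -> 'I_n -> R) i :
  0 < beta -> D%:R <= L%:R * n%:R * q -> (forall l j, `|b l j| <= beta) ->
  \sum_(w | e * linform_scale beta < `|linform y b i w|) prodw f w <= (e ^+ D)^-1.
Proof.
move=> beta0 Dle b_le; have s0 : 0 < linform_scale beta.
  by rewrite !mulr_gt0 // sqrtr_gt0 !mulr_gt0.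
have e0 : 0 < e by exact: expR_gt0.
have es0 := mulr_gt0 e0 s0.
have evenD : ~~ odd D by rewrite DE oddM.
have norm_even (z : R) : `|z| ^+ D = z ^+ D.
  by rewrite -normrX ger0_norm // exprn_even_ge0.
apply: le_trans (_ : \sum_(w | (e * linform_scale beta) ^+ D < linform y b i w ^+ D)
   prodw f w <= _).
  rewrite big_mkcond [leRHS]big_mkcond; apply: ler_sum => w _.
  case: ifPn => [h|_]; last by case: ifP => // _; exact: prodw_ge0.
  rewrite ifT // -(norm_even (linform y b i w)) ltrXn2r //; last exact: ltW.
  by rewrite DE muln_eq0 -lt0n expn_gt0.
apply: le_trans (markov_prodw f_ge0 (exprn_gt0 _ es0) _) _.
  by move=> w; rewrite exprn_even_ge0.
rewrite ler_pdivrMr ?(exprn_gt0 _ es0) //.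
apply: le_trans (linform_even_moment _ Dle b_le) _.
by rewrite [in leRHS]exprMn mulKf // gt_eqF // exprn_gt0.
Qed.

(** Union bound over one trace event and [n^2] linear-form events. *)
Lemma good_event_prob (beta : R) (b : 'I_n -> 'I_L -> 'I_n -> R)
    (E : pred {ffun key -> S}) :
  D%:R <= Num.sqrt L%:R * n%:R * q -> 0 < beta ->
  (forall j l m, `|b j l m| <= beta) ->
  (forall w, (forall x, sqnorm x = 1 -> sqnorm (quad y w *m x) <= (e * quad_scale) ^+ 2) ->
     (forall i j, `|linform y (b j) i w| <= e * linform_scale beta) -> E w) ->
  1 - (n%:R / e ^+ (2 ^ k).*2 + n%:R ^+ 2 / e ^+ D) <= \sum_(w | E w) prodw f w.
Proof.
move=> Dle beta0 b_le goodE.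
have Dle' : D%:R <= L%:R * n%:R * q.
  apply: le_trans Dle _; rewrite -!mulrA ler_wpM2r ?(ltW (mulr_gt0 n0 q_gt0)) //.
  by rewrite -[leRHS]sL2 expr2 ler_peMl ?sqrtr_ge0.
have {1}<- : \sum_w prodw f w = 1.
  by rewrite -(expect_cst f_sum1 1); apply: eq_bigr => w _; rewrite mulr1.
rewrite lerBlDr (bigID E) /= lerD2l.
have sumB_le : \sum_(i < n) \sum_(j < n)
    \sum_(w | e * linform_scale beta < `|linform y (b j) i w|) prodw f w <=
    n%:R ^+ 2 / e ^+ D.
  have -> : n%:R ^+ 2 / e ^+ D = \sum_(i < n) \sum_(j < n) (e ^+ D)^-1.
    by rewrite !sumr_const card_ord -mulrnA -[RHS]mulr_natl natrM expr2.
  apply: ler_sum => i _; apply: ler_sum => j _.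
  exact: linform_tail (b_le j).
apply: le_trans (lerD (quad_tail Dle) sumB_le).
pose A w := (e * quad_scale) ^+ (2 ^ k).*2 < \tr (quad y w ^+ (2 ^ k).*2).
pose badlin i j w := e * linform_scale beta < `|linform y (b j) i w|.
(* Written with indicators, the union bound becomes a pointwise inequality in [w]. *)
have indE (P : pred {ffun key -> S}) :
    \sum_(w | P w) prodw f w = \sum_w prodw f w * (P w)%:R.
  by rewrite big_mkcond; apply: eq_bigr => w _; case: (P w); rewrite ?mulr1 ?mulr0.
under [X in _ <= _ + X]eq_bigr do under eq_bigr do rewrite (indE (badlin _ _)).
under [X in _ <= _ + X]eq_bigr do rewrite exchange_big /=.
rewrite exchange_big !indE -big_split /=; apply: ler_sum => w _.
under [X in _ <= _ + X]eq_bigr do rewrite -mulr_sumr.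
rewrite -mulr_sumr -mulrDr ler_wpM2l ?prodw_ge0 // -/(A w).
have sumB0 : 0 <= \sum_i \sum_j (badlin i j w)%:R :> R.
  by apply: sumr_ge0 => i _; apply: sumr_ge0.
case: (boolP (E w)) => [_|Ew] /=; first by rewrite addr_ge0.
case: (boolP (A w)) => [_|Aw] /=; first by rewrite lerDl.
rewrite add0r.
have [ij /andP[] hbad _|noB] := pickP (fun ij => badlin ij.1 ij.2 w && true).
  rewrite (bigD1 ij.1) //= (bigD1 ij.2) //= hbad -addrA lerDl addr_ge0 //.
    by apply: sumr_ge0.
  by apply: sumr_ge0 => i _; apply: sumr_ge0.
case/negP: Ew; apply: goodE => [x x1|i j]; last first.
  by rewrite leNgt; apply/negP => hbad; have := noB (i, j); rewrite /= /badlin hbad.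
have N0 : (0 < 2 ^ k)%N by rewrite expn_gt0.
(* Raising both sides to the power [2 ^ k] reduces the norm bound to the trace bound. *)
rewrite -(ler_pXn2r N0) ?nnegrE ?exprn_ge0 ?sqnorm_ge0 //; last first.
  by rewrite mulr_ge0 ?expR_ge0 // /quad_scale !mulr_ge0 ?sqrtr_ge0 // ltW.
apply: le_trans (sqnorm_pow2_trace k (quad_sym w) x1) _.
by rewrite -exprM mul2n leNgt.
Qed.
End Concentration.

Lemma spec_norm_le (R : realType) (n : nat) (M : 'M[R]_n) (c : R) :
  (0 < n)%N -> 0 <= c -> (forall x, sqnorm x = 1 -> sqnorm (M *m x) <= c ^+ 2) ->
  spec_norm M <= c.
Proof.
case: n M => // n M _ c0 Mc; apply: ge_sup.
  (* The supremum is bounded by [c] once its set is nonempty; a basis vector, available as the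
     dimension is positive, is a witness. *)
  exists (vnorm2 (M *m delta_mx ord0 ord0)); exists (delta_mx ord0 ord0) => //=.
  rewrite /vnorm2 (bigD1 ord0) //= big1 => [|i i0]; rewrite mxE.
    by rewrite !eqxx expr1n addr0 sqrtr1.
  by rewrite (negPf i0) expr0n.
move=> _ [x x1 <-]; rewrite -(ger0_norm c0) -sqrtr_sqr ler_wsqrtr //.
apply: Mc; rewrite -[LHS]sqr_sqrtr ?sqnorm_ge0 //.
by move: x1; rewrite /vnorm2 /= => ->; rewrite expr1n.
Qed.

(** * The multi-layer model: noise variables and decomposition of the deviation *)

Section MultilayerSBM.
Variables (R : realType) (n K L : nat) (g : 'I_n -> 'I_K) (rho p q : R).
Variable (B0 : 'I_L -> 'M[R]_K).
Hypotheses (n_gt0 : (0 < n)%N) (L_gt0 : (0 < L)%N).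
Hypotheses (p_gt0 : 0 < p) (p_le1 : p <= 1).
Hypothesis B0_sym : forall l, B0 l = (B0 l)^T.
Hypothesis B_ge0 : forall l a b, 0 <= rho * B0 l a b.
Hypothesis B_le1 : forall l a b, rho * B0 l a b <= 1.
Hypothesis B_leq : forall l a b, p * (rho * B0 l a b) <= q.
Local Notation key := ('I_L * 'I_n * 'I_n)%type.
Implicit Types (w : Omega n L) (l : 'I_L) (i j : 'I_n).

(** This is [p] times the entry of [P_l], also for [i = j], where no edge is ever observed;
    [offrate] removes that diagonal. *)
Definition obs_rate l i j : R := p * (rho * B0 l (g i) (g j)).

Definition edge_law (t : key) (b : bool * bool) : R :=
  coord_weight g rho p B0 t.1.1 t.1.2 t.2 b.

Definition edge_noise (t : key) (b : bool * bool) : R :=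
  if (t.1.2 < t.2)%N then (b.1 && b.2)%:R - obs_rate t.1.1 t.1.2 t.2 else 0.

Lemma obs_rate_sym l i j : obs_rate l i j = obs_rate l j i.
Proof. by rewrite /obs_rate [in LHS]B0_sym mxE. Qed.

Lemma obs_rate_itv l i j : 0 <= obs_rate l i j <= 1.
Proof.
rewrite /obs_rate mulr_ge0 ?B_ge0 ?(ltW p_gt0) //=.
by apply: mulr_ile1; rewrite ?B_ge0 ?B_le1 ?(ltW p_gt0).
Qed.

Lemma sum_bits (F : bool * bool -> R) :
  \sum_b F b = F (true, true) + F (true, false) + F (false, true) + F (false, false).
Proof.
rewrite (eq_bigr (fun b => F (b.1, b.2))); last by case.
by rewrite -(pair_bigA _ (fun a b => F (a, b))) /= !big_bool /= !addrA.
Qed.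

Lemma edge_law_ge0 t b : 0 <= edge_law t b.
Proof.
rewrite /edge_law /coord_weight; case: ifP => _; last by case: ifP.
have := B_ge0 t.1.1 (g t.1.2) (g t.2); have := B_le1 t.1.1 (g t.1.2) (g t.2).
move=> *; rewrite mulr_ge0 //; case: ifP => _; rewrite ?subr_ge0 //; exact: ltW.
Qed.

Lemma edge_law_sum1 t : \sum_b edge_law t b = 1.
Proof.
rewrite sum_bits /edge_law /coord_weight; case: ifP => _ /=; last by rewrite !add0r.
ring.
Qed.

Lemma edge_noise_le1 t b : `|edge_noise t b| <= 1.
Proof.
rewrite /edge_noise; case: ifP => _; last by rewrite normr0.
have /andP[] := obs_rate_itv t.1.1 t.1.2 t.2.
by rewrite ler_norml; case: (b.1 && b.2) => /= *; lra.
Qed.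

Lemma edge_noise_mean0 t : \sum_b edge_law t b * edge_noise t b = 0.
Proof.
rewrite sum_bits /edge_law /coord_weight /edge_noise /obs_rate.
by case: ifP => _ /=; ring.
Qed.

(** An observed edge is Bernoulli with rate [r], so its variance is [r (1 - r) <= r]. *)
Lemma edge_noise_var t : 0 <= q -> \sum_b edge_law t b * edge_noise t b ^+ 2 <= q.
Proof.
move=> q0; rewrite sum_bits /edge_law /coord_weight /edge_noise.
case: ifP => _ /=; last by rewrite expr0n !mulr0 !addr0.
have /andP[r0 r1] := obs_rate_itv t.1.1 t.1.2 t.2.
apply: le_trans (B_leq t.1.1 (g t.1.2) (g t.2)).
apply: le_trans (_ : obs_rate t.1.1 t.1.2 t.2 * (1 - obs_rate t.1.1 t.1.2 t.2) <= _).
  by rewrite le_eqVlt; apply/orP; left; apply/eqP; rewrite /obs_rate; ring.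
by rewrite -/(obs_rate _ _ _) ler_piMr //; lra.
Qed.

Definition obs_edge w l i j : bool := Smask w l i j && Aobs w l i j.
Local Notation noise := (centered edge_noise).

Lemma obs_edgeE w l i j : i != j ->
  (obs_edge w l i j)%:R = obs_rate l i j + noise w l i j.
Proof.
rewrite /obs_edge /Smask /Aobs /sym_bit /centered /edge_noise /ekey.
case: ltngtP => [ij|ji|/val_inj->]; last by rewrite eqxx.
  by rewrite /= ij andbC subrKC.
by rewrite /= ji andbC obs_rate_sym subrKC.
Qed.

Lemma noise_diag w l i : noise w l i i = 0.
Proof. by rewrite /centered /edge_noise /ekey ltnn /= ltnn. Qed.

Lemma noise_sym w l i j : noise w l i j = noise w l j i.
Proof. by rewrite /centered ekey_sym. Qed.

Lemma obs_edge_sym w l i j : obs_edge w l i j = obs_edge w l j i.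
Proof.
by rewrite /obs_edge /Smask /Aobs /sym_bit; case: ltngtP => // /val_inj->.
Qed.

Lemma obs_edge_diag w l i : obs_edge w l i i = false.
Proof. by rewrite /obs_edge /Smask /sym_bit ltnn. Qed.

Lemma AtildeE w l i j : Atilde p w l i j = (obs_edge w l i j)%:R / p.
Proof. by rewrite mxE /obs_edge; case: Smask; rewrite //= mul0r. Qed.

Lemma dtildeE w l i : (dtilde p w l i)%:R = \sum_j (obs_edge w l i j)%:R :> R.
Proof.
rewrite -natr_sum; congr (_%:R).
rewrite /dtilde -sum1_card big_mkcond; apply: eq_bigr => j _.
have in_nbrs : (j \in [set j0 | Atilde p w l i j0 == p^-1]%classic) =
    (Atilde p w l i j == p^-1).
  by apply/idP/idP => h; [exact: (set_mem h)|exact: (mem_set h)].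
rewrite in_nbrs AtildeE; case: obs_edge; rewrite ?mul1r ?eqxx // mul0r eq_sym invr_eq0.
by rewrite gt_eqF.
Qed.

Lemma PmatE l i j : Pmat g rho (B0 l) i j = rho * B0 l (g i) (g j).
Proof.
have trE a : (Theta R g)^T a j = if g j == a then 1 else 0 by rewrite !mxE.
rewrite mxE (bigD1 (g j)) //= big1 ?addr0 => [|a aj]; last first.
  by rewrite trE eq_sym (negPf aj) mulr0.
rewrite trE eqxx mulr1 mxE (bigD1 (g i)) //= big1 ?addr0.
  by rewrite !mxE eqxx mul1r.
by move=> a ai; rewrite mxE eq_sym (negPf ai) mul0r.
Qed.

Definition offrate j l k : R := if k == j then 0 else obs_rate l k j.

(** The two cross terms of rate and noise, less the terms [k = i] and [k = j] that [P_l^2] has and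
    the square of the zero-diagonal rates lacks. *)
Definition linear_part w : 'M[R]_n := \matrix_(i, j) (if i == j then 0 else
  linform edge_noise (offrate j) i w + linform edge_noise (offrate i) j w
  - \sum_l obs_rate l i j * (obs_rate l i i + obs_rate l j j)).

Definition diag_bias : 'M[R]_n :=
  \matrix_(i, j) (if i == j then - \sum_l \sum_k obs_rate l i k ^+ 2 else 0).

Lemma Mbar_sub_Pi w : Mbar p w - Pi g rho B0 =
  (L%:R * n%:R * p ^+ 2)^-1 *: (quad edge_noise w + linear_part w + diag_bias).
Proof.
have p0 : p != 0 by rewrite gt_eqF.
have n0 : n%:R != 0 :> R by rewrite pnatr_eq0 -lt0n.
have L0 : L%:R != 0 :> R by rewrite pnatr_eq0 -lt0n.
apply/matrixP => i j.
rewrite /Mbar /Pi -scalerBr -sumrB !mxE summxE.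
have -> : (L%:R * n%:R * p ^+ 2)^-1 = L%:R^-1 * (n%:R * p ^+ 2)^-1.
  by rewrite -invfM [in RHS]mulrA.
rewrite -mulrA; congr (_ * _).
rewrite (_ : \sum_l _ = (n%:R * p ^+ 2)^-1 * \sum_l
   ((if i == j then 0 else \sum_k (obs_edge w l i k)%:R * (obs_edge w l k j)%:R) -
    \sum_k obs_rate l i k * obs_rate l k j)); last first.
  rewrite mulr_sumr; apply: eq_bigr => l _.
  rewrite !mxE.
  have -> : \sum_k Atilde p w l i k * Atilde p w l k j =
     (p ^+ 2)^-1 * \sum_k (obs_edge w l i k)%:R * (obs_edge w l k j)%:R.
    rewrite mulr_sumr; apply: eq_bigr => k _; rewrite !AtildeE; field.
    by rewrite p0.
  have -> : \sum_k Pmat g rho (B0 l) i k * Pmat g rho (B0 l) k j =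
     (p ^+ 2)^-1 * \sum_k obs_rate l i k * obs_rate l k j.
    rewrite mulr_sumr; apply: eq_bigr => k _; rewrite !PmatE /obs_rate; field.
    by rewrite p0.
  case: eqP => [<-|_]; last by field; rewrite p0 n0.
  (* Bits are idempotent, so the diagonal of the square is the degree and cancels against
     [Dtilde]. *)
  rewrite dtildeE (_ : \sum_k _ * _ = \sum_k (obs_edge w l i k)%:R).
    by field; rewrite p0 n0.
  by apply: eq_bigr => k _; rewrite obs_edge_sym; case: obs_edge; rewrite ?mulr1 ?mulr0.
congr (_ * _); case: eqP => [<-|/eqP ij].
  rewrite add0r add0r -sumrN; apply: eq_bigr => l _; rewrite sub0r; congr (- _).
  by apply: eq_bigr => k _; rewrite obs_rate_sym expr2.
rewrite addr0 /linform -!big_split /= -sumrB -!big_split /=; apply: eq_bigr => l _.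
have ji : j != i by rewrite eq_sym.
pose r0 a k := if k == a then 0 else obs_rate l k a.
(* With the rate set to zero on the diagonal, the splitting holds for every [k]. *)
have edge_split a k : (obs_edge w l a k)%:R = r0 a k + noise w l a k.
  rewrite /r0; case: eqP => [->|/eqP ka]; last by rewrite obs_rate_sym obs_edgeE // eq_sym.
  by rewrite noise_diag obs_edge_diag addr0.
have -> : \sum_k obs_rate l i k * obs_rate l k j =
    \sum_k r0 i k * r0 j k + obs_rate l i j * (obs_rate l i i + obs_rate l j j).
  rewrite (bigD1 i) //= (bigD1 j) //= [X in _ = X + _](bigD1 i) //=.
  rewrite [X in _ = _ + X + _](bigD1 j) //= /r0 !eqxx.
  rewrite (eq_bigr (fun k => r0 i k * r0 j k)); last first.
    by move=> k /andP[ki kj]; rewrite /r0 (negPf ki) (negPf kj) obs_rate_sym.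
  by rewrite /r0; ring.
rewrite opprD addrA -sumrB -big_split addrA -big_split /=; congr (_ - _); apply: eq_bigr => k _.
rewrite edge_split [obs_edge w l k j]obs_edge_sym edge_split /offrate -/(r0 j k) -/(r0 i k).
by rewrite [noise w l k j]noise_sym; ring.
Qed.


Lemma obs_rate_leq l i j : obs_rate l i j <= q.
Proof. exact: B_leq. Qed.

Lemma linear_part_le w (h : R) i j : 0 <= h ->
  (forall i j, `|linform edge_noise (offrate j) i w| <= h) ->
  `|linear_part w i j| <= 2 * h + 2 * L%:R * q ^+ 2.
Proof.
move=> h0 lin_le; rewrite mxE.
have q0 : 0 <= q.
  apply: le_trans (obs_rate_leq (Ordinal L_gt0) i i).
  by case/andP: (obs_rate_itv (Ordinal L_gt0) i i).
case: eqP => _; first by rewrite normr0 addr_ge0 // !mulr_ge0 ?sqr_ge0.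
apply: le_trans (ler_normB _ _) _; apply: lerD.
  apply: le_trans (ler_normD _ _) _.
  by have := lin_le i j; have := lin_le j i; lra.
apply: le_trans (ler_norm_sum _ _ _) _.
apply: le_trans (_ : \sum_(l < L) 2 * q ^+ 2 <= _); last first.
  by rewrite sumr_const card_ord -mulr_natr le_eqVlt; apply/orP; left; apply/eqP; ring.
apply: ler_sum => l _.
have /andP[rij _] := obs_rate_itv l i j; have /andP[rii _] := obs_rate_itv l i i.
have /andP[rjj _] := obs_rate_itv l j j.
rewrite (ger0_norm (mulr_ge0 rij (addr_ge0 rii rjj))) mulrC expr2 mulrA.
apply: ler_pM; rewrite ?addr_ge0 ?obs_rate_leq //.
by have := obs_rate_leq l i i; have := obs_rate_leq l j j; lra.
Qed.

Lemma diag_bias_le i : `|diag_bias i i| <= L%:R * n%:R * q ^+ 2.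
Proof.
rewrite mxE eqxx normrN; apply: le_trans (ler_norm_sum _ _ _) _.
apply: le_trans (_ : \sum_(l < L) \sum_(k < n) q ^+ 2 <= _); last first.
  by rewrite !sumr_const !card_ord -mulrnA -[leLHS]mulr_natl natrM [n%:R * _]mulrC.
apply: ler_sum => l _; apply: le_trans (ler_norm_sum _ _ _) _.
apply: ler_sum => m _; have /andP[rim _] := obs_rate_itv l i m.
rewrite ger0_norm ?sqr_ge0 // lerXn2r ?nnegrE ?obs_rate_leq //.
exact: le_trans (obs_rate_leq l i m).
Qed.

Local Notation e := (expR 1 : R).

(** The quadratic part is bounded by the trace method, the linear part by [n] times its largest
    entry, the bias by its largest diagonal entry. *)
Lemma deviation_prob (k D : nat) : D = (4 * 2 ^ k)%N -> 0 < q ->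
  D%:R <= Num.sqrt L%:R * n%:R * q ->
  1 - (n%:R / e ^+ (2 ^ k).*2 + n%:R ^+ 2 / e ^+ D) <=
  Prob g rho p B0 (fun w => spec_norm (Mbar p w - Pi g rho B0) <=
    (L%:R * n%:R * p ^+ 2)^-1 * (2 * (e * quad_scale n L q D +
      n%:R * (2 * (e * linform_scale n L q D q) + 2 * L%:R * q ^+ 2) +
      L%:R * n%:R * q ^+ 2))).
Proof.
move=> DE q0 Dle; have e0 : 0 < e by exact: expR_gt0.
have qs0 : 0 <= e * quad_scale n L q D.
  by rewrite /quad_scale !mulr_ge0 ?sqrtr_ge0 // ltW.
have ls0 : 0 <= e * linform_scale n L q D q.
  by rewrite /linform_scale !mulr_ge0 ?sqrtr_ge0 // ltW.
have bias0 : 0 <= L%:R * n%:R * q ^+ 2 by rewrite mulr_ge0 ?sqr_ge0 // mulr_ge0.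
have off0 : 0 <= 2 * (e * linform_scale n L q D q) + 2 * L%:R * q ^+ 2.
  by rewrite addr_ge0 ?(mulr_ge0 _ ls0) // mulr_ge0 ?sqr_ge0 // mulr_ge0.
apply: (good_event_prob edge_law_ge0 edge_law_sum1 edge_noise_le1 edge_noise_mean0
  (fun t => edge_noise_var t (ltW q0)) n_gt0 L_gt0 q0 DE Dle q0 (b := offrate)).
  move=> j l m; rewrite /offrate; case: ifP => _; first by rewrite normr0 ltW.
  by have /andP[r0 _] := obs_rate_itv l m j; rewrite ger0_norm // obs_rate_leq.
move=> w quad_le lin_le; apply: spec_norm_le => //.
  apply: mulr_ge0; first by rewrite invr_ge0 mulr_ge0 ?sqr_ge0 // mulr_ge0.
  exact: mulr_ge0 (ler0n _ 2) (addr_ge0 (addr_ge0 qs0 (mulr_ge0 (ler0n _ n) off0)) bias0).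
move=> x x1; rewrite Mbar_sub_Pi -scalemxAl sqnormZ !mulmxDl exprMn.
(* The outer factor 2 covers the 3 of [sqnormD3]: [3 (a^2 + b^2 + c^2) <= (2 (a + b + c))^2] for
   nonnegative terms. *)
rewrite ler_wpM2l ?sqr_ge0 //; apply: le_trans (sqnormD3 _ _ _) _.
have := quad_le x x1.
have := sqnorm_mulmx_entries x (fun i j => linear_part_le i j ls0 lin_le).
have diag_off i j : i != j -> diag_bias i j = 0 by move=> /negPf ij; rewrite mxE ij.
have := sqnorm_mulmx_diag x diag_off diag_bias_le.
rewrite x1 !mulr1.
have := mulr_ge0 (ler0n R n) off0.
move: (n%:R * (2 * _ + _)) qs0 bias0 => H.
move: (e * _) (_ * q ^+ 2) => A C; nra.
Qed.
End MultilayerSBM.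

(** * Rounding the logarithm up to a power of two, and the failure probability *)

Lemma pow2_between (R : realType) (x : R) : 2^-1 <= x ->
  exists k : nat, x <= (2 ^ k)%:R /\ (2 ^ k)%:R <= 4 * x.
Proof.
move=> x2.
have ex : exists k : nat, x <= (2 ^ k)%:R.
  exists (Num.bound `|x|); apply: le_trans (ler_norm _) _.
  by apply: ltW (lt_le_trans (archi_boundP (normr_ge0 x)) _); rewrite ler_nat; exact: ltnW (ltn_expl _ _).
(* For the least exponent, [1 <= 4 x] follows from [2^-1 <= x] at zero; otherwise half of the power
   lies below [x]. *)
case: (ex_minnP ex) => -[|k] xk kmin.
  by exists 0%N; split=> //; rewrite expn0; lra.
exists k.+1; split=> //; rewrite expnS natrM.
have : ~~ (x <= (2 ^ k)%:R) by apply/negP => /kmin; rewrite ltnn.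
by rewrite -ltNge => /ltW; lra.
Qed.

Lemma ln_nat_ge_half (R : realType) (m : nat) : (2 <= m)%N -> 2^-1 <= ln (m%:R : R).
Proof.
move=> m2; have m0 : 0 < m%:R :> R by rewrite ltr0n (leq_trans _ m2).
rewrite -ler_expR lnK //; apply: le_trans (_ : 2 <= _); last by rewrite ler_nat.
(* [exp (-1/2) >= 1/2] gives [exp (1/2) <= 2]. *)
have := expR_ge1Dx (- 2^-1 : R); rewrite expRN => h.
rewrite -[leLHS]invrK -[leRHS]invrK lef_pV2 ?posrE ?invr_gt0 ?expR_gt0 //.
by apply: le_trans h; lra.
Qed.

(** With [m = L + n] and [E = exp (2 ^ k) >= m], both [n m <= E^2] and [n^2 m <= E^4], so each term
    is at most [1 / m]. *)
Lemma tail_budget (R : realType) (n L k : nat) : (0 < n)%N -> (0 < L)%N ->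
  ln (L + n)%:R <= (2 ^ k)%:R :> R ->
  (n%:R / expR 1 ^+ (2 ^ k).*2 + n%:R ^+ 2 / expR 1 ^+ (4 * 2 ^ k) : R)
    <= 2 * powR (L + n)%:R (- 1).
Proof.
move=> n0 L0 lnk; set m : R := (L + n)%:R.
have m1 : 1 <= m by rewrite ler1n addn_gt0 L0.
have m0 : 0 < m by apply: lt_le_trans m1.
have nm : n%:R <= m by rewrite ler_nat leq_addl.
rewrite powR_inv1 ?(ltW m0) // -!expRM_natr !mul1r.
have m_le : m <= expR (2 ^ k)%:R by rewrite -[leLHS]lnK ?posrE // ler_expR.
have E0 : 0 < expR (2 ^ k)%:R :> R by exact: expR_gt0.
have -> : expR (2 ^ k).*2%:R = expR (2 ^ k)%:R ^+ 2 :> R.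
  by rewrite -expRM_natl -natrM mul2n.
have -> : expR (4 * 2 ^ k)%:R = expR (2 ^ k)%:R ^+ 4 :> R.
  by rewrite -expRM_natl -natrM.
set E := expR _ in m_le E0 *.
rewrite [leRHS](_ : _ = m^-1 + m^-1); last by ring.
apply: lerD.
  rewrite ler_pdivrMr ?exprn_gt0 // mulrC ler_pdivlMr // expr2.
  by apply: ler_pM; rewrite ?ler0n ?(ltW m0) ?m_le ?(le_trans nm m_le).
rewrite ler_pdivrMr ?exprn_gt0 // mulrC ler_pdivlMr //.
apply: le_trans (_ : m ^+ 2 * m <= _).
  by rewrite ler_wpM2r ?(ltW m0) // lerXn2r ?nnegrE ?ler0n ?(ltW m0).
apply: le_trans (_ : m ^+ 4 <= _); last by rewrite lerXn2r ?nnegrE ?(ltW m0) ?(ltW E0).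
by rewrite -exprSr ler_weXn2l.
Qed.

(** * A common bound for both sparsity regimes, and its two specialisations *)

Lemma sqrt_le_sqr (R : rcfType) (x z : R) : 0 <= z -> x <= z ^+ 2 -> Num.sqrt x <= z.
Proof. by move=> z0 xz; rewrite -(ger0_norm z0) -sqrtr_sqr ler_wsqrtr. Qed.

(** [T] is the target rate; [a] and [b] measure the quadratic and linear contributions against it.
    Taking [q = c p rho], the constant [c] dominates the entries of [B0] and ensures
    [D <= 16 ln (L + n) <= sqrt L n q]. *)
Lemma deviation_bound (R : realType) (n K L : nat) (g : 'I_n -> 'I_K)
    (rho p c a b CB T : R) (B0 : 'I_L -> 'M[R]_K) :
  (0 < n)%N -> (0 < L)%N -> 0 < p -> p <= 1 -> 0 < rho ->
  (forall l, B0 l = (B0 l)^T) ->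
  (forall l x y, 0 <= B0 l x y /\ B0 l x y <= CB) ->
  (forall l x y, rho * B0 l x y <= 1) ->
  0 < c -> CB <= c -> 0 <= a -> 0 <= b -> 0 <= T ->
  16 * ln (L + n)%:R <= c * (Num.sqrt L%:R * n%:R * (p * rho)) ->
  rho * ln (L + n)%:R / (p * Num.sqrt L%:R) <= a * T ->
  rho * Num.sqrt (c * (n%:R * p * rho * ln (L + n)%:R)) / (p * Num.sqrt L%:R) <= b * T ->
  1 - 2 * powR (L + n)%:R (- 1) <= Prob g rho p B0
    (fun w => spec_norm (Mbar p w - Pi g rho B0) <=
      (expR 1 * (128 * c * a + 32 * c * b) + 6 * c ^+ 2) * Num.max T (rho ^+ 2)).
Proof.
move=> n0 L0 p0 p1 rho0 B0s B0b B0le1 c0 CBc a0 b0 T0 ln_le aT bT.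
set l := ln _ in ln_le aT bT *.
have l2 : 2^-1 <= l by apply: ln_nat_ge_half; rewrite -(addn1 1) leq_add.
have [k [lk kl]] := pow2_between l2.
pose D := (4 * 2 ^ k)%N; pose q := c * (p * rho).
have q0 : 0 < q by rewrite !mulr_gt0.
have Dl : D%:R <= 16 * l by rewrite natrM; lra.
have Dle : D%:R <= Num.sqrt L%:R * n%:R * q.
  by apply: le_trans Dl _; apply: le_trans ln_le _; rewrite /q; lra.
have B_ge0 i x y : 0 <= rho * B0 i x y by rewrite mulr_ge0 ?(ltW rho0) //; case: (B0b i x y).
have B_leq i x y : p * (rho * B0 i x y) <= q.
  rewrite mulrA [leLHS]mulrC ler_wpM2r ?(ltW (mulr_gt0 p0 rho0)) //.
  exact: le_trans (proj2 (B0b i x y)) CBc.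
have := deviation_prob g n0 L0 p0 p1 B0s B_ge0 B0le1 B_leq (erefl D) q0 Dle.
move=> dev; apply: le_trans (le_trans dev _).
  by rewrite lerD2l lerN2; exact: tail_budget.
rewrite /Prob big_mkcond [leRHS]big_mkcond; apply: ler_sum => w _.
have w0 : 0 <= weight g rho p B0 w.
  by apply: prodr_ge0 => t _; exact: (edge_law_ge0 g p0 p1 B_ge0 B0le1).
case: ifPn => [dev_w|_]; last by case: ifP.
rewrite ifT //; apply: le_trans dev_w _.
set e := expR 1; have e0 : 0 < e by exact: expR_gt0.
set mx := Num.max T _.
have Tmx : T <= mx by rewrite le_max lexx.
have rmx : rho ^+ 2 <= mx by rewrite le_max lexx orbT.
have nR : 0 < n%:R :> R by rewrite ltr0n.
have LR : 0 < L%:R :> R by rewrite ltr0n.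
set s := Num.sqrt L%:R in Dle ln_le aT bT *.
have s0 : 0 < s by rewrite sqrtr_gt0.
have sL : L%:R = s ^+ 2 :> R by rewrite sqr_sqrtr // ltW.
rewrite /quad_scale /linform_scale -/s.
have V_le : Num.sqrt (L%:R * n%:R * q * D%:R) <=
    4 * s * Num.sqrt (c * (n%:R * p * rho * l)).
  rewrite -[4](_ : Num.sqrt (4 ^+ 2) = 4); last by rewrite sqrtr_sqr ger0_norm.
  rewrite -!sqrtrM ?mulr_ge0 ?sqr_ge0 ?(ltW LR) //.
  rewrite ler_wsqrtr //.
  apply: le_trans (_ : L%:R * n%:R * q * (16 * l) <= _).
    by rewrite ler_wpM2l // !mulr_ge0 // ltW.
  by rewrite le_eqVlt; apply/orP; left; apply/eqP; rewrite /q; ring.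
set V := Num.sqrt (L%:R * _ * _ * _) in V_le *.
set V' := Num.sqrt (c * _) in bT V_le.
pose F1 := rho * l / (p * s); pose F2 := rho * V' / (p * s).
apply: le_trans (_ : e * (128 * c * F1 + 32 * c * F2) + 6 * c ^+ 2 * rho ^+ 2 <= _); last first.
  rewrite [leRHS]mulrDl; apply: lerD; last first.
    by rewrite ler_wpM2l // mulr_ge0 // sqr_ge0.
  rewrite -[leRHS]mulrA ler_wpM2l ?(ltW e0) // [leRHS]mulrDl -!mulrA; apply: lerD.
    by rewrite !ler_wpM2l ?(ltW c0) //; apply: le_trans aT _; rewrite ler_wpM2l.
  by rewrite !ler_wpM2l ?(ltW c0) //; apply: le_trans bT _; rewrite ler_wpM2l.
apply: le_trans (_ : (L%:R * n%:R * p ^+ 2)^-1 * (2 * (e * (4 * (16 * l) * (s * n%:R * q)) +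
   n%:R * (2 * (e * (2 * q * (4 * s * V'))) + 2 * L%:R * q ^+ 2) + L%:R * n%:R * q ^+ 2)) <= _).
  rewrite ler_wpM2l ?invr_ge0 ?(mulr_ge0 (mulr_ge0 (ltW LR) (ltW nR)) (sqr_ge0 p)) //.
  rewrite ler_wpM2l // lerD2r; apply: lerD.
    rewrite ler_wpM2l ?(ltW e0) // ler_wpM2r ?(ltW (mulr_gt0 (mulr_gt0 s0 nR) q0)) //.
    by rewrite ler_wpM2l.
  rewrite ler_wpM2l ?(ltW nR) // lerD2r ler_wpM2l // ler_wpM2l ?(ltW e0) //.
  by rewrite ler_wpM2l // mulr_ge0 // ltW.
(* An exact identity: [128 = 2 * 4 * 16], [32 = 2 * 2 * 2 * 4] and [6 = 2 * (2 + 1)]. *)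
rewrite le_eqVlt; apply/orP; left; apply/eqP; rewrite /F1 /F2 /q sL; field.
by rewrite !gt_eqF.
Qed.

(** Both parts apply [deviation_bound] with [T] the first term of the maximum; the exponent 1 and
    the constant 2 in the probability come from [tail_budget]. *)
Theorem theorem2 (R : realType) (K : nat) (CB : R) :
  (* part (i) *)
  (forall ca cb : R, 0 < ca -> 0 < cb ->
   exists C c1 C' : R, 0 < c1 /\
   forall (n L : nat) (p rho : R) (g : 'I_n -> 'I_K) (B0 : 'I_L -> 'M[R]_K),
     (1 <= n)%N -> (1 <= L)%N -> 0 < p -> p <= 1 -> 0 < rho ->
     (forall l, B0 l = (B0 l)^T) ->
     (forall l a b, 0 <= B0 l a b /\ B0 l a b <= CB) ->
     (forall l a b, rho * B0 l a b <= 1) ->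
     ln ((L + n)%:R) / (p * n%:R * Num.sqrt L%:R) <= ca * rho ->
     rho <= cb / (p * n%:R) ->
     Prob g rho p B0
       (fun w => spec_norm (Mbar p w - Pi g rho B0) <=
          C * Num.max (rho * ln ((L + n)%:R) / (p * Num.sqrt p * Num.sqrt L%:R))
                      (rho ^+ 2))
     >= 1 - C' * powR ((L + n)%:R) (- c1)) /\
  (* part (ii) *)
  (forall ca : R, 0 < ca ->
   exists C c2 C' : R, 0 < c2 /\
   forall (n L : nat) (p rho : R) (g : 'I_n -> 'I_K) (B0 : 'I_L -> 'M[R]_K),
     (1 <= n)%N -> (1 <= L)%N -> 0 < p -> p <= 1 -> 0 < rho ->
     (forall l, B0 l = (B0 l)^T) ->
     (forall l a b, 0 <= B0 l a b /\ B0 l a b <= CB) ->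
     (forall l a b, rho * B0 l a b <= 1) ->
     ln ((L + n)%:R) / (p * n%:R) <= ca * rho ->
     Prob g rho p B0
       (fun w => spec_norm (Mbar p w - Pi g rho B0) <=
          C * Num.max (Num.sqrt n%:R * rho * Num.sqrt rho * Num.sqrt (ln ((L + n)%:R))
                         / (Num.sqrt p * Num.sqrt L%:R))
                      (rho ^+ 2))
     >= 1 - C' * powR ((L + n)%:R) (- c2)).
Proof.
split.
(* [16 * ca] absorbs the 16 in front of the logarithm, and the absolute value bounds [CB] whatever
   its sign. *)
- move=> ca cb ca0 cb0; pose c := 16 * ca + `|CB|.
  have c0 : 0 < c by rewrite ltr_pwDl // mulr_gt0.
  have CBc : CB <= c by rewrite (le_trans (ler_norm _)) // lerDr mulr_ge0 // ltW.
  (* With [X = c * cb] and [l >= 1/2], [X l <= 2 X l^2 <= (b l)^2], which bounds the root in the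
     linear term. *)
  pose b := 1 + 2 * (c * cb).
  have b0 : 0 <= b by rewrite addr_ge0 // !mulr_ge0 // ltW.
  exists (expR 1 * (128 * c * 1 + 32 * c * b) + 6 * c ^+ 2), 1, 2; split=> //.
  move=> n L p rho g B0 n0 L0 p0 p1 rho0 B0s B0b B0le1 lb ub.
  set l := ln _ in lb *.
  have l2 : 2^-1 <= l by apply: ln_nat_ge_half; rewrite -(addn1 1) leq_add.
  have nR : 0 < n%:R :> R by rewrite ltr0n.
  set s := Num.sqrt L%:R in lb *.
  have s0 : 0 < s by rewrite sqrtr_gt0 ltr0n.
  have sp0 : 0 < Num.sqrt p by rewrite sqrtr_gt0.
  have sp1 : Num.sqrt p <= 1 by rewrite -[leRHS]sqrtr1 ler_wsqrtr.
  have l0 : 0 < l by apply: lt_le_trans l2; rewrite invr_gt0.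
  set T := rho * l / _.
  have T0 : 0 <= T by rewrite /T divr_ge0 ?mulr_ge0 ?ltW.
  (* The bound obtained has [p] in the denominator; [sqrt p <= 1] relaxes it to [p^(3/2)]. *)
  have lT : rho * l / (p * s) <= T.
    rewrite /T ler_wpM2l ?(ltW (mulr_gt0 rho0 l0)) //.
    rewrite lef_pV2 ?posrE ?mulr_gt0 // ler_wpM2r ?(ltW s0) //.
    by rewrite ler_piMr ?(ltW p0).
  apply: deviation_bound => //.
  + move: lb; rewrite ler_pdivrMr ?mulr_gt0 // -/l -/s => lb.
    have : 0 <= `|CB| * (s * n%:R * (p * rho)).
      by rewrite mulr_ge0 // ltW // !mulr_gt0.
    by rewrite /c; lra.
  + by rewrite mul1r.
  + rewrite -/l -/s; apply: le_trans (_ : b * (rho * l / (p * s)) <= _); last first.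
      by rewrite ler_wpM2l.
    rewrite [leRHS](_ : _ = rho * (b * l) / (p * s)); last by ring.
    rewrite ler_wpM2r ?invr_ge0 ?(ltW (mulr_gt0 p0 s0)) //.
    rewrite ler_wpM2l ?(ltW rho0) //; apply: sqrt_le_sqr.
      by rewrite mulr_ge0 // ltW.
    have ub' : n%:R * p * rho <= cb.
      by move: ub; rewrite ler_pdivlMr ?mulr_gt0 //; lra.
    apply: le_trans (_ : c * (cb * l) <= _).
      by rewrite ler_wpM2l ?(ltW c0) // ler_wpM2r ?(ltW l0).
    have X0 : 0 < c * cb by rewrite mulr_gt0.
    apply: le_trans (_ : c * cb * (2 * l ^+ 2) <= _).
      by rewrite -mulrA ler_wpM2l ?(ltW c0) // ler_wpM2l ?(ltW cb0) //; nra.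
    rewrite exprMn mulrA ler_wpM2r ?sqr_ge0 // /b; nra.
- move=> ca ca0; pose c := 16 * ca + `|CB|.
  have c0 : 0 < c by rewrite ltr_pwDl // mulr_gt0.
  have CBc : CB <= c by rewrite (le_trans (ler_norm _)) // lerDr mulr_ge0 // ltW.
  (* [sqrt ca] comes from [l <= sqrt (ca n p rho) * sqrt l]; [sqrt c] makes the linear term equal to
     its multiple of [T]. *)
  exists (expR 1 * (128 * c * Num.sqrt ca + 32 * c * Num.sqrt c) + 6 * c ^+ 2), 1, 2.
  split=> // n L p rho g B0 n0 L0 p0 p1 rho0 B0s B0b B0le1 lb.
  set l := ln _ in lb *.
  have l2 : 2^-1 <= l by apply: ln_nat_ge_half; rewrite -(addn1 1) leq_add.
  have nR : 0 < n%:R :> R by rewrite ltr0n.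
  set s := Num.sqrt L%:R.
  have s0 : 0 < s by rewrite sqrtr_gt0 ltr0n.
  have s1 : 1 <= s by rewrite -[leLHS]sqrtr1 ler_wsqrtr // ler1n.
  have l0 : 0 < l by apply: lt_le_trans l2; rewrite invr_gt0.
  have lb' : l <= ca * (n%:R * p * rho).
    by move: lb; rewrite ler_pdivrMr ?mulr_gt0 //; lra.
  set T := _ / (Num.sqrt p * s).
  have T0 : 0 <= T by rewrite /T divr_ge0 ?mulr_ge0 ?sqrtr_ge0 // ltW.
  have sp0 : 0 < Num.sqrt p by rewrite sqrtr_gt0.
  have pE : p = Num.sqrt p ^+ 2 by rewrite sqr_sqrtr // ltW.
  have TE : T = rho * (Num.sqrt (n%:R * p * rho) * Num.sqrt l) / (p * s).
    rewrite /T !sqrtrM ?mulr_ge0 ?(ltW p0) //.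
    move: sp0 pE; set sp := Num.sqrt p => sp0 pE.
    by rewrite pE; field; rewrite !gt_eqF.
  have npr0 : 0 <= n%:R * p * rho by rewrite !mulr_ge0 // ltW.
  apply: deviation_bound => //; rewrite ?sqrtr_ge0 // -/l -/s.
  + have : 0 <= `|CB| * (s * n%:R * (p * rho)).
      by rewrite mulr_ge0 // ltW // !mulr_gt0.
    (* The hypothesis of this part carries no [sqrt L]; [s >= 1] supplies it. *)
    have := ler_wpM2l (mulr_ge0 (ltW ca0) npr0) s1.
    by rewrite /c; lra.
  + rewrite TE [leRHS](_ : _ = rho * (Num.sqrt ca * Num.sqrt (n%:R * p * rho) *
      Num.sqrt l) / (p * s)); last by ring.
    rewrite ler_wpM2r ?invr_ge0 ?(ltW (mulr_gt0 p0 s0)) //.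
    rewrite ler_wpM2l ?(ltW rho0) // -sqrtrM ?(ltW ca0) //.
    by rewrite -[leLHS]sqr_sqrtr ?(ltW l0) // expr2 ler_wpM2r ?sqrtr_ge0 // ler_wsqrtr.
  + rewrite TE sqrtrM ?(ltW c0) // [Num.sqrt (_ * l)]sqrtrM //.
    by rewrite le_eqVlt; apply/orP; left; apply/eqP; ring.
Qed.
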